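(* Let $k\geq 3$ be a fixed integer. For every constant $C>0$ there is a constant $c>0$ (depending only on $k$ and $C$) such that for all integers $n\geq 1$ and $\ell>k$ with $\ell\leq C\sqrt{n}$, $$f(n,\ell,k)\geq c\,\frac{n^{(k-1)/k}}{\ell^{(k-2)/k}}.$$
   Context: A set of points in the plane has ''at most $j$ collinear'' if every line contains at most $j$ points of the set. For integers $k<\ell$, $f(n,\ell,k)$ is defined to be the maximum integer such that every set of $n$ points in the plane $\mathbb{R}^2$ with at most $\ell$ collinear contains a subset of $f(n,\ell,k)$ points with at most $k$ collinear. The asymptotic hypothesis $\ell\leq O(\sqrt n)$ and the conclusion $\Omega_k(\cdot)$ are written out here with explicit constants. *)

(* Defs.v *)
From mathcomp Require Import all_boot all_order all_algebra finmap.
From mathcomp Require Import boolp reals exp.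
From mathcomp Require Import ring.

Set Implicit Arguments.
Unset Strict Implicit.
Unset Printing Implicit Defensive.

Import Order.TTheory GRing.Theory Num.Theory.

Local Open Scope fset_scope.
Local Open Scope ring_scope.

Section Collinear.
Variable R : realType.

Definition on_line (a b c : R) (p : R * R) : bool :=
  a * p.1 + b * p.2 == c.

Definition at_most_collinear (j : nat) (P : {fset R * R}) : Prop :=
  forall a b c : R, (a, b) != (0, 0) ->
    (#|` [fset p in P | on_line a b c p]| <= j)%N.

Definition guaranteed (n l k m : nat) : Prop :=
  forall P : {fset R * R}, #|` P| = n -> at_most_collinear l P ->
    exists Q : {fset R * R},
      [/\ Q `<=` P, #|` Q| = m & at_most_collinear k Q].

(* For l >= 2 this is the maximum of all m with guaranteed n l k m: the bound
   m <= n excludes nothing, see f_guaranteed and f_max. *)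
Definition f (n l k : nat) : nat :=
  \max_(m < n.+1 | `[< guaranteed n l k m >]) m.

Lemma f_guaranteed n l k : guaranteed n l k (f n l k).
Proof.
have g0 : guaranteed n l k 0.
  move=> P _ _; exists fset0; split; rewrite ?fsub0set ?cardfs0 //.
  move=> a b c _; apply: leq_trans (fsubset_leq_card (_ : _ `<=` fset0)) _.
    by apply/fsubsetP => p; rewrite !inE => /andP[].
  by rewrite cardfs0.
have h0 : `[< guaranteed n l k (@ord0 n) >] by apply/asboolP.
rewrite /f; case: (@eq_bigmax_cond _ (mem (fun m : 'I_n.+1 =>
  `[< guaranteed n l k m >])) (fun m : 'I_n.+1 => m : nat)).
  by apply/card_gt0P; exists ord0.
by move=> i /asboolP gi E; rewrite [X in guaranteed _ _ _ X]E.
Qed.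

Let parab (i : nat) : R * R := (i%:R, i%:R ^+ 2).

Let parab_inj : injective parab.
Proof. by move=> i j [/eqP]; rewrite eqr_nat => /eqP. Qed.

Let parabola_collinear n :
  at_most_collinear 2 [fset parab i | i in iota 0 n].
Proof.
move=> a b c ab0; pose p : {poly R} := Poly [:: - c; a; b].
have p0 : p != 0.
  apply: contraNneq ab0 => /(congr1 (fun q : {poly R} => (q`_1, q`_2))).
  by rewrite /p !coef_Poly !coef0 /= => ->.
set S := [fset _ in _ | _].
have Sx q : q \in S -> q = (q.1, q.1 ^+ 2) /\ root p q.1.
  rewrite !inE /= => /andP[/imfsetP[i _ ->] /eqP E]; split => //.
  apply/rootP; rewrite horner_Poly /=. rewrite -E /=; ring.
rewrite -(size_map fst (S : seq _)) -ltnS.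
apply: leq_trans (max_poly_roots (p := p) (rs := map fst (S : seq _)) p0 _ _) _.
- by apply/allP => x /mapP[q /Sx[_ h] ->].
- rewrite map_inj_in_uniq ?fset_uniq // => q r /Sx[-> _] /Sx[-> _] /= -> //.
- exact: size_Poly.
Qed.

Lemma f_max n l k m : (2 <= l)%N -> guaranteed n l k m -> (m <= f n l k)%N.
Proof.
move=> l2 g; have mn : (m < n.+1)%N.
  have [||Q [sQ <- _]] := g [fset parab i | i in iota 0 n].
  - rewrite card_imfset //=.
    by rewrite undup_id ?iota_uniq // size_iota.
  - by move=> a b c h; apply: leq_trans (parabola_collinear n c h) l2.
  apply: leq_trans (fsubset_leq_card sQ) _.
  rewrite card_imfset //=.
  by rewrite undup_id ?iota_uniq // size_iota.
exact: (@leq_bigmax_cond _ (fun m : 'I_n.+1 => `[< guaranteed n l k m >])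
  (fun m : 'I_n.+1 => m : nat) (Ordinal mn) (asboolT g)).
Qed.

End Collinear.

(* Main.v *)
(* The collinear (k+1)-subsets of the point set form a hypergraph, and a random
   sample from which one point of every surviving edge is deleted has at most k
   collinear points. Summing i^k over the Szemeredi-Trotter bound n^2/i^3 for the
   number of lines with at least i <= l = O(sqrt n) points gives O(n^2 l^(k-2))
   edges, so sampling with probability about (n l^(k-2))^(-1/k) yields the bound.

   Szemeredi-Trotter follows Szekely: draw the segments between consecutive points
   of the rich non-vertical lines, whose crossings are at most the pairs of lines,
   and apply the crossing inequality. The latter is obtained by sampling vertices
   from the linear bound |E| <= 3 |V| for non-crossing segments. For straight
   segments this has a direct proof: every segment is the steepest one leaving its
   left end to the right, or the uppermost one reaching its right end from the
   left, or the first segment below some vertex. *)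
Require Import Defs.
From mathcomp Require Import all_boot all_order all_algebra.
From mathcomp Require Import finmap boolp reals exp.
From mathcomp Require Import ring lra zify.

Set Implicit Arguments.
Unset Strict Implicit.
Unset Printing Implicit Defensive.

Import Order.TTheory GRing.Theory Num.Theory.

(** * Arithmetic of power sums and of the incidence bound *)

Lemma leq_bin_exp n m : ('C(n, m) <= n ^ m)%N.
Proof.
elim: m n => [|m IH] n; first by rewrite bin0.
apply: (@leq_trans (m.+1 * 'C(n, m.+1))); first by rewrite leq_pmull.
rewrite -mul_bin_diag expnS leq_mul2l; apply/orP; right.
by apply: leq_trans (IH _) _; case: m {IH} => // m; rewrite leq_exp2r // leq_pred.
Qed.

Lemma expnS_diff_leq m k : (m.+1 ^ k.+1 <= m ^ k.+1 + k.+1 * m.+1 ^ k)%N.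
Proof.
elim: k => [|k IH]; first by rewrite !expn1 expn0 muln1 addn1.
rewrite expnS mulSn (expnS m k.+1).
have h1 := leq_mul (leqnn m) IH.
have h2 : (m * (k.+1 * m.+1 ^ k) <= k.+1 * m.+1 ^ k.+1)%N.
  by rewrite expnS mulnCA leq_mul2l leq_mul2r leqnSn !orbT.
apply: leq_trans (leq_add (leqnn _) h1) _.
by rewrite mulnDr mulSn addnCA !leq_add2l.
Qed.

Lemma expn_leq_sum m k : (m ^ k.+1 <= \sum_(i < m) k.+1 * i.+1 ^ k)%N.
Proof.
elim: m => [|m IH]; first by rewrite exp0n.
by rewrite big_ord_recr /=; apply: leq_trans (expnS_diff_leq _ _) _; rewrite leq_add2r.
Qed.

(** Layer-cake summation: [#|A| ^ k.+1] is at most the sum of [k.+1 * i ^ k] over [1 <= i <= #|A|].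
    After exchanging the sums, level [i] contributes at most [k.+1 * M * i ^ (k - 3)], hence at most
    [k.+1 * M * l ^ (k - 3)], and there are [l] levels. *)
Lemma sum_card_exp (T : finType) (L : {set {set T}}) (M l k : nat) : (3 <= k)%N ->
  (forall A, A \in L -> #|A| <= l)%N ->
  (forall i, 0 < i <= l -> #|[set A in L | i <= #|A|]| * i ^ 3 <= M)%N ->
  (\sum_(A in L) #|A| ^ k.+1 <= k.+1 * M * l ^ (k - 2))%N.
Proof.
move=> k3 Ll NM.
have : (\sum_(A in L) #|A| ^ k.+1 <=
    \sum_(A in L) \sum_(i < l | i < #|A|) k.+1 * i.+1 ^ k)%N.
  apply: leq_sum => A AL; rewrite -(big_ord_widen l (fun i => k.+1 * i.+1 ^ k)%N) ?Ll //.
  exact: expn_leq_sum.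
move/leq_trans; apply.
under eq_bigr => A _ do rewrite big_mkcond.
rewrite exchange_big /=.
apply: (@leq_trans (\sum_(i < l) k.+1 * M * l ^ (k - 3))); last first.
  rewrite sum_nat_const card_ord (_ : k - 2 = (k - 3).+1); last lia.
  by rewrite expnS mulnCA.
apply: leq_sum => i _; rewrite -big_mkcondr /=.
rewrite (eq_bigl (mem [set A in L | i < #|A|])); last by move=> A; rewrite !inE.
rewrite sum_nat_const mulnCA -mulnA leq_mul2l /=.
rewrite -{1}(subnKC k3) expnD mulnA leq_mul //; first by apply: NM; rewrite ltn_ord.
case: (k - 3) => // j; by rewrite leq_exp2r.
Qed.

(** Here [N] stands for the number of [i]-rich lines on [n] points, so that [N * i.-1] bounds the
    number of edges from below and [N ^ 2] the crossings from above. The hypothesis on all [q] is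
    the crossing inequality at sampling rate [1 / q.+1]. *)
Lemma szemeredi_trotter_arith (N n i D : nat) : (2 <= i)%N -> (i ^ 2 <= D * n)%N ->
  (forall q, N * i.-1 * q.+1 ^ 2 <= 3 * n * q.+1 ^ 3 + N ^ 2)%N ->
  (N * i ^ 3 <= (2304 + 12 * D) * n ^ 2)%N.
Proof.
move=> i2 iD cr; have n0 : (0 < n)%N.
  by case: n iD {cr} => //; rewrite muln0 leqn0 expn_eq0; case: i i2.
have i2' : (i <= 2 * i.-1)%N by lia.
(* With few edges, [N * i <= 12 * n] and the assumption on [i ^ 2] suffice. *)
have [small|big] := ltnP (N * i.-1) (6 * n).
  have h1 : (N * i <= 12 * n)%N.
    by apply: leq_trans (leq_mul (leqnn N) i2') _; lia.
  rewrite (expnS i 2) mulnA; apply: leq_trans (leq_mul h1 iD) _.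
  by rewrite -mulnn; lia.
set e := (N * i.-1)%N in big cr.
(* This rate makes the vertex term [3 * n * Q ^ 3] at most half of [e * Q ^ 2], so the crossing term
   carries the other half. As [Q] is at least [e / (12 * n)], this gives
   [e ^ 3 <= 288 * n ^ 2 * N ^ 2]; passing from [i.-1] to [i] costs a factor 8, and
   [8 * 288 = 2304]. *)
pose Q := (e %/ (6 * n))%N.
have Q0 : (0 < Q)%N by rewrite divn_gt0 ?muln_gt0.
have Qle : (6 * n * Q <= e)%N by rewrite mulnC leq_divM.
have Qge : (e <= 12 * n * Q)%N.
  have := ltn_ceil e (_ : 0 < 6 * n)%N; rewrite muln_gt0 n0 => /(_ isT); rewrite -/Q.
  nia.
have := cr Q.-1; rewrite prednK // => crQ.
have h1 : (e * Q ^ 2 <= 2 * N ^ 2)%N.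
  have := leq_mul Qle (leqnn (Q ^ 2)); move: crQ; rewrite (expnS Q 2).
  move: (Q ^ 2)%N => u; nia.
have h2 : (e ^ 3 <= 288 * n ^ 2 * N ^ 2)%N.
  have := leq_mul (leq_mul Qge Qge) (leqnn e).
  have := leq_mul (leqnn (144 * n ^ 2)) h1; rewrite -!mulnn !expnS expn0 !muln1.
  nia.
have [->|N0] := posnP N; first by rewrite mul0n.
have h3 : (N * i.-1 ^ 3 <= 288 * n ^ 2)%N.
  rewrite -(leq_pmul2r (_ : 0 < N ^ 2)%N) ?expn_gt0 ?N0 //.
  apply: leq_trans h2; rewrite /e expnMn -mulnA (mulnC (i.-1 ^ 3)%N) mulnA -expnS.
  by [].
have h4 : (i ^ 3 <= 8 * i.-1 ^ 3)%N by rewrite -(expnMn 2 _ 3) leq_exp2r.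
apply: leq_trans (leq_mul (leqnn N) h4) _; rewrite mulnCA.
apply: leq_trans (leq_mul (leqnn 8) h3) _.
by rewrite mulnA leq_mul2r; apply/orP; right; lia.
Qed.

Local Open Scope ring_scope.

(** * Random sampling *)

Section Sampling.
Variables (T : finType) (q : nat).

(* A uniform [g] gives a random subset of [T] containing each point
   independently with probability [1 / q.+1]. *)
Definition sample (g : {ffun T -> 'I_q.+1}) : {set T} := [set x | g x == ord0].

Lemma card_sample_superset (A : {set T}) :
  (#|[set g | A \subset sample g]| * q.+1 ^ #|A| = q.+1 ^ #|T|)%N.
Proof.
pose F x : pred 'I_q.+1 := if x \in A then pred1 ord0 else predT.
have -> : #|[set g | A \subset sample g]| = #|family F|.
  apply: eq_card => g; rewrite inE; apply/subsetP/familyP => h x.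
    by rewrite /F unfold_in; case: ifP => [/h|_]; rewrite ?inE.
  by move=> xA; have := h x; rewrite /F xA [x \in sample g]inE.
rewrite card_family foldrE big_map -(prod_nat_const (mem A)) -(prod_nat_const T).
rewrite [X in (_ * X)%N]big_mkcond big_enum -big_split /=; apply: eq_bigr => x _.
by rewrite /F; case: ifP => _; rewrite ?card1 ?card_ord ?muln1 ?mul1n.
Qed.

(** Linearity of expectation with denominators cleared: each [F a] survives with probability
    [q.+1 ^ - m]. *)
Lemma sum_card_sampled (I : finType) (D : {set I}) (F : I -> {set T}) m :
  (forall a, a \in D -> #|F a| = m) ->
  ((\sum_g #|[set a in D | F a \subset sample g]|) * q.+1 ^ m =
    #|D| * q.+1 ^ #|T|)%N.
Proof.
move=> Fm; under eq_bigr => g _.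
  rewrite -sum1_card; under eq_bigl => a do rewrite inE.
  rewrite big_mkcondr; over.
rewrite exchange_big /= big_distrl -sum_nat_const; apply: eq_bigr => a aD.
rewrite -(card_sample_superset (F a)) (Fm a aD); congr (_ * _)%N.
by rewrite -big_mkcond -sum1dep_card.
Qed.

Lemma sum_card_sample : ((\sum_g #|sample g|) * q.+1 = #|T| * q.+1 ^ #|T|)%N.
Proof.
have := @sum_card_sampled T setT (fun x => [set x]) 1 (fun x _ => cards1 x).
rewrite expn1 cardsT => <-; congr (_ * _)%N; apply: eq_bigr => g _.
by apply: eq_card => x; rewrite [RHS]inE in_setT sub1set.
Qed.

Lemma subset_avoiding (S : {set T}) (D : {set {set T}}) :
  (forall B, B \in D -> (0 < #|B|)%N) ->
  exists Q : {set T}, [/\ Q \subset S, (#|S| <= #|Q| + #|D|)%N &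
    forall B, B \in D -> ~~ (B \subset Q)].
Proof.
move=> D0; pose rep (B : {set T}) := [pick x in B].
pose U := [set x | Some x \in rep @: D].
exists (S :\: U); split; first exact: subsetDl.
  rewrite -(cardsID U) addnC leq_add2l.
  apply: leq_trans (subset_leq_card (subsetIr _ _)) _.
  rewrite -(card_imset _ (@Some_inj _)); apply: leq_trans (leq_imset_card rep D).
  by apply/subset_leq_card/subsetP => _ /imsetP[x + ->]; rewrite inE.
move=> B BD; have := imset_f rep BD; rewrite /rep; case: pickP => [x xB|B0 _].
  move=> xD; apply/negP => /subsetP/(_ x xB); by rewrite !inE xD.
by have := D0 B BD; rewrite (eq_card0 B0).
Qed.

(* Alteration: delete a point from each edge surviving in a random sample. *)
Lemma large_independent_set (D : {set {set T}}) k :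
  (forall B, B \in D -> #|B| = k.+1) ->
  (2 * #|D| <= #|T| * q.+1 ^ k)%N ->
  exists Q : {set T}, (#|T| <= 2 * q.+1 * #|Q|)%N /\
    forall B, B \in D -> ~~ (B \subset Q).
Proof.
move=> Dk small; pose bad g := [set B in D | B \subset sample g].
(* Averaged over [g], the right side is [2 * #|T|], while [2 * q.+1 * #|bad g|] averages to
   [2 * #|D| / q.+1 ^ k], at most [#|T|]. Hence some [g] satisfies the inequality. *)
have [g hg] : exists g, (#|T| + 2 * q.+1 * #|bad g| <= 2 * q.+1 * #|sample g|)%N.
  apply/existsP; apply: contraPT small => /existsPn none; apply/negP; rewrite -ltnNge.
  have := sum_card_sampled (F := id) Dk; rewrite -/(bad _) => Sbad.
  have [p pE] : {p | p = 2 * q.+1}%N by exists (2 * q.+1)%N.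
  rewrite -pE in none.
  have : (\sum_g (p * #|sample g|).+1 <= \sum_g (#|T| + p * #|bad g|))%N.
    by apply: leq_sum => g _; rewrite ltnNge; apply: none.
  under eq_bigr => g _ do rewrite -addn1.
  rewrite !big_split /= -!big_distrr /= !sum_nat_const card_ffun card_ord.
  move: Sbad sum_card_sample; rewrite expnS.
  set b := (\sum_g _)%N; set s := (\sum_g _)%N.
  have : (0 < q.+1 ^ #|T|)%N by rewrite expn_gt0.
  have : (0 < q.+1 ^ k)%N by rewrite expn_gt0.
  move: (q.+1 ^ #|T|)%N (q.+1 ^ k)%N => N K K0 N0 Sb Ss; rewrite muln1 => H.
  have H1 : (#|T| * N < 2 * b * q.+1)%N.
    move: H Ss; rewrite pE; move: #|T| => n; lia.
  rewrite -(ltn_pmul2r N0).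
  have : (#|T| * N * K < 2 * b * q.+1 * K)%N by rewrite ltn_pmul2r.
  by move: Sb; move: #|T| #|D| => n d; lia.
have [Q [QS cQ indep]] : exists Q : {set T}, [/\ Q \subset sample g,
    (#|sample g| <= #|Q| + #|bad g|)%N & forall B, B \in bad g -> ~~ (B \subset Q)].
  by apply: subset_avoiding => B; rewrite inE => /andP[/Dk -> _].
exists Q; split; last first.
  move=> B BD; apply/negP => BQ; have := indep B; rewrite inE BD BQ.
  by rewrite (subset_trans BQ QS) => /(_ isT).
have : (2 * q.+1 * #|sample g| <= 2 * q.+1 * (#|Q| + #|bad g|))%N by rewrite leq_mul2l cQ orbT.
by move: hg; rewrite mulnDr; lia.
Qed.
End Sampling.

(** * Straight-line drawings *)

Section PlaneGraph.
Variables (R : realFieldType) (T : finType) (px py : T -> R).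
Hypothesis pos_inj : forall p q, px p = px q -> py p = py q -> p = q.
Implicit Types (e f g : T * T) (S : {set T}) (E : {set T * T}).

(** Edges are pairs directed from left to right. [height] follows the whole line of an edge, whereas
    [over] is strict, so that edges meeting at a common end do not count as crossing. *)
Definition slope e : R := (py e.2 - py e.1) / (px e.2 - px e.1).
Definition height e (x : R) : R := py e.1 + slope e * (x - px e.1).
Definition over e (x : R) : bool := px e.1 < x < px e.2.

Lemma heightE e x y : height e x = height e y + slope e * (x - y).
Proof. by rewrite /height; ring. Qed.

Lemma height_left e : height e (px e.1) = py e.1.
Proof. by rewrite /height subrr mulr0 addr0. Qed.

Lemma height_right e : px e.1 < px e.2 -> height e (px e.2) = py e.2.
Proof.
by move=> lt12; rewrite /height /slope divfK ?subr_eq0 ?gt_eqF // addrC subrK.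
Qed.

Lemma height_crossing e f x y : x < y ->
  height e x < height f x -> height f y < height e y ->
  exists2 z, x < z < y & height e z = height f z.
Proof.
move=> ltxy ltx lty.
have := heightE e y x; have := heightE f y x => Ef Ee.
pose u := height f x - height e x; pose s := slope e - slope f.
have u0 : 0 < u by rewrite subr_gt0.
have us : u < s * (y - x) by rewrite /u /s; lra.
have s0 : 0 < s.
  have p : 0 < s * (y - x) by apply: lt_trans us.
  by rewrite -(pmulr_lgt0 _ (_ : 0 < y - x)) ?subr_gt0.
exists (x + u / s).
  rewrite ltrDl divr_gt0 //= -ltrBrDl ltr_pdivrMr // mulrC; exact: us.
rewrite (heightE e _ x) (heightE f _ x) (_ : x + u / s - x = u / s); last by ring.
have : s * (u / s) = u by rewrite mulrC divfK // gt_eqF.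
rewrite {1}/s {2}/u; lra.
Qed.

Definition noncrossing E := forall e f, e \in E -> f \in E ->
  forall x, over e x -> over f x -> height e x = height f x -> e = f.

Definition embedded S E :=
  (forall e, e \in E -> [/\ e.1 \in S, e.2 \in S & px e.1 < px e.2]) /\
  (forall e p, e \in E -> p \in S -> over e (px p) ->
     height e (px p) != py p).

Definition sees E (v : T) e : bool :=
  [&& over e (px v), height e (px v) < py v &
    [forall f in E, over f (px v) ==>
       ~~ (height e (px v) < height f (px v) < py v)]].

(** A strict change of order would force a common point strictly between [x] and [y], interior to
    both edges. The conclusion is weak because the edges may share an end at [y]. *)
Lemma noncrossing_le E e f x y : noncrossing E -> e \in E -> f \in E ->
  px e.1 <= x <= px e.2 -> px f.1 <= x <= px f.2 ->
  px e.1 <= y <= px e.2 -> px f.1 <= y <= px f.2 ->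
  height e x < height f x -> height e y <= height f y.
Proof.
move=> nc eE fE /andP[ex1 ex2] /andP[fx1 fx2] /andP[ey1 ey2] /andP[fy1 fy2] ltx.
rewrite leNgt; apply/negP => lty.
have nef : e != f by apply: contraTneq ltx => ->; rewrite ltxx.
have [z [oe of_ hz]] : exists z, [/\ over e z, over f z & height e z = height f z].
  case: (ltgtP x y) => xy.
  - have [z /andP[z1 z2] hz] := height_crossing xy ltx lty.
    by exists z; split; rewrite ?/over ?(le_lt_trans _ z1) ?(lt_le_trans z2).
  - have [z /andP[z1 z2] hz] := height_crossing xy lty ltx.
    by exists z; split; rewrite ?/over ?(le_lt_trans _ z1) ?(lt_le_trans z2).
  - by move: lty; rewrite -xy ltNge (ltW ltx).
by move/eqP: nef; apply; apply: (nc e f eE fE z).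
Qed.

(* Let [g] be the edge just above [e] at its left end. The leftmost point of [S]
   above [e] and not above [g] sees [e], since an edge in between would have its
   left end among these points. *)
Lemma edge_is_extreme_or_seen S E e : embedded S E -> noncrossing E -> e \in E ->
  (exists2 g, g \in E & g.1 = e.1 /\ slope e < slope g) ->
  (exists2 h, h \in E & h.2 = e.2 /\ slope h < slope e) ->
  exists2 v, v \in S & sees E v e.
Proof.
move=> [emb vtx] nc eE [g0 g0E g0P] [h hE [h2 hs]].
have [e1S e2S e12] := emb _ eE; have [h1S h2S h12] := emb _ hE.
have [g [gE g1 gs] gmin] : exists2 g, [/\ g \in E, g.1 = e.1 & slope e < slope g] &
    forall f, f \in E -> f.1 = e.1 -> slope e < slope f -> slope g <= slope f.
  pose P f := [&& f \in E, f.1 == e.1 & slope e < slope f].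
  have P0 : P g0 by rewrite /P g0E; case: g0P => -> ->; rewrite eqxx.
  case: (arg_minP slope P0) => g /and3P[gE /eqP g1 gs] gmin.
  exists g => // f fE f1 fs; apply: gmin; by rewrite /P fE f1 eqxx.
have [g1S g2S g12] := emb _ gE.
have ge x : px e.1 < x -> height e x < height g x.
  move=> xa; rewrite /height g1 ltrD2l ltr_pM2r // subr_gt0 //.
have hb : height h (px e.2) = py e.2 by rewrite -h2 height_right.
have he x : x < px e.2 -> height e x < height h x.
  move=> xb; rewrite (heightE e x (px e.2)) (heightE h x (px e.2)) hb.
  by rewrite height_right // ltrD2l ltr_nM2r // subr_lt0.
pose W v := [&& v \in S, over e (px v), height e (px v) < py v,
  px v <= px g.2 & py v <= height g (px v)].
(* If [g] ends before [e], its right end is in [W]. Otherwise [g] passes above [e.2], where [h]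
   arrives from above [e]. Either the left end of [h] lies between [e] and [g], or [h] is strictly
   above [e] at [e.1] without exceeding [g], which meets [e] there: a contradiction. *)
have [w Ww] : exists w, W w.
  have [cb|bc] := ltP (px g.2) (px e.2).
    exists g.2; rewrite /W g2S lexx height_right // lexx /over cb -g1 g12 /=.
    by rewrite andbT -(height_right g12) ge // -g1.
  have gb : height h (px e.2) < height g (px e.2).
    by rewrite hb -height_right // ge.
  have [ad|da] := ltP (px e.1) (px h.1).
    have h1b : px h.1 < px e.2 by rewrite -h2.
    exists h.1; rewrite /W h1S /over ad h1b -(height_left h) he //=.
    rewrite (le_trans (ltW h1b) bc) /=.
    apply: (noncrossing_le (x := px e.2) nc hE gE) => //.
    - by rewrite -h2 (ltW h12) lexx.
    - by rewrite bc g1 ltW.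
    - by rewrite lexx ltW.
    - by rewrite g1 (ltW ad) (le_trans (ltW h1b) bc).
  have : height h (px e.1) <= height g (px e.1).
    apply: (noncrossing_le (x := px e.2) nc hE gE) => //.
    - by rewrite -h2 (ltW h12) lexx.
    - by rewrite bc g1 ltW.
    - by rewrite da h2 ltW.
    - by rewrite g1 lexx (le_trans (ltW e12) bc).
  have -> : height g (px e.1) = height e (px e.1).
    by rewrite height_left -g1 height_left.
  by rewrite leNgt he.
case: (arg_minP px Ww) => v /and5P[vS /andP[av vb] ev vc vg] vmin.
exists v => //; rewrite /sees /over av vb ev /=.
apply/forall_inP => f fE; apply/implyP => /andP[fv1 fv2]; apply/negP => /andP[ef fv].
have [f1S f2S f12] := emb _ fE.
have fg := lt_le_trans fv vg.
have fbelow y : px e.1 <= y <= px v -> px f.1 <= y ->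
    height e y <= height f y <= height g y.
  move=> /andP[ay yv] fy; apply/andP; split.
    apply: (noncrossing_le (x := px v) nc eE fE) => //;
      by rewrite ?fy ?ay ?(ltW av) ?(ltW vb) ?(ltW fv1) ?(ltW fv2) ?(le_trans yv (ltW vb))
                 ?(le_trans yv (ltW fv2)).
  apply: (noncrossing_le (x := px v) nc fE gE) => //; rewrite ?g1;
    by rewrite ?fy ?ay ?(ltW av) ?(ltW fv1) ?(ltW fv2) ?vc ?(le_trans yv vc)
                 ?(le_trans yv (ltW fv2)).
(* Suppose [f] separates [e] from [v]. If [f] starts to the right of [e.1], its left end is in [W]
   and contradicts the choice of [v]. Otherwise it is squeezed through [e.1]: starting there
   contradicts the minimal slope of [g], and starting earlier puts a vertex inside [f]. *)
have [aw|wa] := ltP (px e.1) (px f.1).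
  have /andP[l1 l2] : height e (px f.1) <= height f (px f.1) <= height g (px f.1).
    by apply: fbelow; rewrite ?(ltW aw) ?(ltW fv1).
  suff /vmin : W f.1 by rewrite leNgt fv1.
  have oef : over e (px f.1) by rewrite /over aw (lt_trans fv1).
  rewrite /W f1S oef (le_trans (ltW fv1) vc) /=.
  by rewrite -(height_left f) l2 andbT lt_neqAle l1 andbT height_left vtx.
have fa : height f (px e.1) = py e.1.
  have : height e (px e.1) <= height f (px e.1) <= height g (px e.1).
    by apply: fbelow; rewrite ?lexx ?(ltW av).
  have -> : height g (px e.1) = py e.1 by rewrite -g1 height_left.
  by rewrite height_left => h0; apply/eqP; rewrite eq_le andbC.
have [wa'|wa'|wa'] := ltgtP (px f.1) (px e.1); last 2 first.
- by rewrite ltNge wa in wa'.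
- have f1 : f.1 = e.1 by apply: pos_inj => //; rewrite -fa -wa' height_left.
  have efs : slope e < slope f.
    by move: ef; rewrite /height f1 ltrD2l ltr_pM2r // subr_gt0.
  have := gmin _ fE f1 efs; rewrite leNgt => /negP; apply.
  by move: fg; rewrite /height f1 g1 ltrD2l ltr_pM2r // subr_gt0.
by have := vtx f e.1 fE e1S; rewrite fa eqxx /over wa' (lt_trans av) // => /(_ isT).
Qed.

(** Neither of two seen edges can lie above the other at [px v], so they meet there. *)
Lemma sees_inj E v e f : noncrossing E -> e \in E -> f \in E ->
  sees E v e -> sees E v f -> e = f.
Proof.
move=> nc eE fE /and3P[oe ev /forall_inP eP] /and3P[of_ fv /forall_inP fP].
apply: (nc e f eE fE (px v)) => //; apply/eqP; rewrite eq_le.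
have := eP f fE; have := fP e eE.
by rewrite oe of_ ev fv !andbT /= -!leNgt => -> ->.
Qed.

Lemma same_left_eq E e f : noncrossing E -> e \in E -> f \in E ->
  px e.1 < px e.2 -> px f.1 < px f.2 ->
  e.1 = f.1 -> slope e = slope f -> e = f.
Proof.
move=> nc eE fE e12 f12 e1 es; pose m := Num.min (px e.2) (px f.2).
have me : px e.1 < m by rewrite lt_min e12 e1 f12.
apply: (nc e f eE fE ((px e.1 + m) / 2)); last by rewrite /height e1 es.
  by rewrite /over midf_lt //= (lt_le_trans (midf_lt me).2) // ge_min lexx.
by rewrite /over -e1 midf_lt //= (lt_le_trans (midf_lt me).2) // ge_min lexx orbT.
Qed.

Lemma same_right_eq E e f : noncrossing E -> e \in E -> f \in E ->
  px e.1 < px e.2 -> px f.1 < px f.2 ->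
  e.2 = f.2 -> slope e = slope f -> e = f.
Proof.
move=> nc eE fE e12 f12 e2 es; pose m := Num.max (px e.1) (px f.1).
have me : m < px e.2 by rewrite gt_max e12 e2 f12.
apply: (nc e f eE fE ((m + px e.2) / 2)).
- by rewrite /over midf_lt //= andbT (le_lt_trans _ (midf_lt me).1) // le_max lexx.
- by rewrite /over -e2 midf_lt //= andbT (le_lt_trans _ (midf_lt me).1) // le_max lexx orbT.
rewrite (heightE e _ (px e.2)) (heightE f _ (px e.2)) height_right // e2.
by rewrite height_right // es.
Qed.

(** The classes [E1], [E2] and [E3] cover [E], and each injects into [S]: by the left end, by the
    right end, and by a vertex that sees the edge. *)
Lemma card_noncrossing S E :
  embedded S E -> noncrossing E -> (#|E| <= 3 * #|S|)%N.
Proof.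
move=> emb nc; have [ends _] := emb.
pose top_left e := [forall g in E, (g.1 == e.1) ==> (slope g <= slope e)].
pose top_right e := [forall g in E, (g.2 == e.2) ==> (slope e <= slope g)].
pose seen e := [exists v in S, sees E v e].
pose E1 := [set e in E | top_left e]; pose E2 := [set e in E | top_right e].
pose E3 := [set e in E | seen e].
have c1 : (#|E1| <= #|S|)%N.
  rewrite -(card_in_imset (f := fst)); last first.
    move=> e f; rewrite !inE => /andP[eE /forall_inP eP] /andP[fE /forall_inP fP] ef.
    have [_ _ e12] := ends _ eE; have [_ _ f12] := ends _ fE.
    apply: (same_left_eq nc) => //; apply/eqP; rewrite eq_le.
    by have := eP f fE; have := fP e eE; rewrite ef eqxx /= => -> ->.
  apply/subset_leq_card/subsetP => _ /imsetP[e + ->]; rewrite inE => /andP[eE _].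
  by have [] := ends _ eE.
have c2 : (#|E2| <= #|S|)%N.
  rewrite -(card_in_imset (f := snd)); last first.
    move=> e f; rewrite !inE => /andP[eE /forall_inP eP] /andP[fE /forall_inP fP] ef.
    have [_ _ e12] := ends _ eE; have [_ _ f12] := ends _ fE.
    apply: (same_right_eq nc) => //; apply/eqP; rewrite eq_le.
    by have := eP f fE; have := fP e eE; rewrite ef eqxx /= => -> ->.
  apply/subset_leq_card/subsetP => _ /imsetP[e + ->]; rewrite inE => /andP[eE _].
  by have [] := ends _ eE.
pose seer e := odflt e.1 [pick v in S | sees E v e].
have seerP e : seen e -> seer e \in S /\ sees E (seer e) e.
  move=> /exists_inP[v vS ve]; rewrite /seer; case: pickP => [w /andP[] // | /(_ v)].
  by rewrite vS ve.
have c3 : (#|E3| <= #|S|)%N.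
  rewrite -(card_in_imset (f := seer)); last first.
    move=> e f; rewrite !inE => /andP[eE /seerP[_ es]] /andP[fE /seerP[_ fs]] ef.
    by apply: sees_inj es _ => //; rewrite ef.
  apply/subset_leq_card/subsetP => _ /imsetP[e + ->]; rewrite inE => /andP[_ /seerP[]] //.
have /subset_leq_card : E \subset E1 :|: E2 :|: E3.
  apply/subsetP => e eE; rewrite !inE eE /=.
  case: (boolP (top_left e)) => //= /forall_inPn[g gE].
  rewrite negb_imply -ltNge => /andP[/eqP g1 gs].
  case: (boolP (top_right e)) => //= /forall_inPn[h hE].
  rewrite negb_imply -ltNge => /andP[/eqP h2 hs].
  have [||v vS ve] := edge_is_extreme_or_seen emb nc eE; first by exists g.
    by exists h.
  by apply/exists_inP; exists v.
move/leq_trans; apply; apply: leq_trans (leq_card_setU _ _) _.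
rewrite mulSn mulSn mul1n addnA leq_add //.
by apply: leq_trans (leq_card_setU _ _) _; rewrite leq_add.
Qed.

(** * The crossing inequality *)

Definition cross e f : Prop :=
  exists x, [/\ over e x, over f x & height e x = height f x].

(** Pairs are ordered, so each crossing is counted twice; this agrees with the later count by
    ordered pairs of lines. *)
Definition crossings E : {set (T * T) * (T * T)} :=
  [set z | [&& z.1 \in E, z.2 \in E, z.1 != z.2 & `[< cross z.1 z.2 >]]].

Lemma crossingsP E e f : reflect
  [/\ e \in E, f \in E, e != f & cross e f] ((e, f) \in crossings E).
Proof.
by rewrite inE; apply: (iffP and4P) => -[? ? ? /asboolP ?]; split=> //; apply/asboolP.
Qed.

(** Removing the first edge of every crossing pair leaves a noncrossing drawing. *)
Lemma card_edges_crossings S E :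
  embedded S E -> (#|E| <= 3 * #|S| + #|crossings E|)%N.
Proof.
move=> [ends vtx]; pose D := [set z.1 | z in crossings E].
have DE : D \subset E.
  by apply/subsetP => _ /imsetP[z + ->]; rewrite inE => /and4P[].
rewrite -(cardsID D) (setIidPr DE) addnC leq_add ?leq_imset_card //.
apply: card_noncrossing.
  by split=> [e /setDP[eE _] | e p /setDP[eE _]]; [apply: ends | apply: vtx].
move=> e f /setDP[eE eD] /setDP[fE _] x oe of_ ef.
apply/eqP; apply: contraR eD => nef; apply/imsetP; exists (e, f) => //.
by rewrite inE eE fE nef /=; apply/asboolP; exists x.
Qed.

(** Equal slopes at a common point put both edges on one line. As no vertex is interior to an edge,
    overlapping edges there have the same ends and coincide. *)
Lemma cross_slope S E e f : embedded S E -> e \in E -> f \in E -> e != f ->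
  cross e f -> slope e != slope f.
Proof.
move=> [ends vtx] + + + [x []].
wlog le1 : e f / px e.1 <= px f.1.
  move=> W eE fE nef oe of_ ef; have [le|/ltW le] := leP (px e.1) (px f.1).
    exact: W.
  by rewrite eq_sym; apply: W; rewrite // eq_sym.
move=> eE fE nef /andP[ex1 ex2] /andP[fx1 fx2] ef; apply/negP => /eqP sl.
have hh y : height e y = height f y.
  by rewrite (heightE e y x) (heightE f y x) ef sl.
have [e1S e2S e12] := ends _ eE; have [f1S f2S f12] := ends _ fE.
have ne := vtx _ _ eE; have nf := vtx _ _ fE.
have e1 : e.1 = f.1.
  move: le1; rewrite le_eqVlt => /orP[/eqP e1|lt1].
    by apply: pos_inj => //; rewrite -(height_left e) hh e1 height_left.
  by have := ne _ f1S; rewrite /over lt1 (lt_trans fx1) // hh height_left eqxx => /(_ isT).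
have e2 : e.2 = f.2.
  have [lt2|lt2|eq2] := ltgtP (px e.2) (px f.2).
  - by have := nf _ e2S; rewrite /over lt2 (lt_trans fx1) // -hh height_right // eqxx => /(_ isT).
  - by have := ne _ f2S; rewrite /over lt2 (lt_trans ex1) // hh height_right // eqxx => /(_ isT).
  by apply: pos_inj => //; rewrite -(height_right e12) hh eq2 height_right.
by case/eqP: nef; rewrite (surjective_pairing e) e1 e2 -surjective_pairing.
Qed.

Definition ends e : {set T} := [set e.1; e.2].

Lemma card_ends e : px e.1 < px e.2 -> #|ends e| = 2.
Proof.
move=> e12; rewrite cards2; case: eqP => // e1; by rewrite e1 ltxx in e12.
Qed.

(** A shared left or right end would be a second common point of two lines of different slopes, and
    a left end of one cannot be the right end of the other since their ranges overlap. A crossing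
    thus survives sampling with the fourth power of the rate. *)
Lemma card_crossing_ends S E z : embedded S E -> z \in crossings E ->
  #|ends z.1 :|: ends z.2| = 4.
Proof.
case: z => e f emb /crossingsP[eE fE nef cr].
have sl := cross_slope emb eE fE nef cr.
have [ends_ _] := emb; have [_ _ e12] := ends_ _ eE; have [_ _ f12] := ends_ _ fE.
rewrite cardsU !card_ends // disjoint_setI0 ?cards0 //.
have [x [/andP[ex1 ex2] /andP[fx1 fx2] ef]] := cr.
have same y : px e.1 <= y <= px e.2 -> y != x -> height e y != height f y.
  move=> _ yx; apply: contra_neq sl => efy.
  have : (slope e - slope f) * (y - x) = 0.
    rewrite mulrBl; move: efy; rewrite (heightE e y x) (heightE f y x) ef.
    by move/addrI => ->; rewrite subrr.
  by move/eqP; rewrite mulf_eq0 subr_eq0 [y - x == 0]subr_eq0 (negPf yx) orbF => /eqP.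
rewrite -setI_eq0; apply/eqP/setP => p; rewrite !inE.
apply/negP => /andP[/orP[]/eqP-> /orP[]/eqP ep].
- have := same (px e.1); rewrite lexx ltW // lt_eqF // height_left.
  by rewrite ep height_left eqxx => /(_ isT isT).
- by move: fx2; rewrite -ep ltNge (ltW ex1).
- by move: fx1; rewrite -ep ltNge (ltW ex2).
- have := same (px e.2); rewrite lexx ltW // gt_eqF // height_right //.
  by rewrite ep height_right // eqxx => /(_ isT isT).
Qed.

(** The linear bound is averaged over samples of rate [1 / q.+1]: vertices, edges and crossings
    survive with powers 1, 2 and 4 of the rate. Everything is multiplied by [q.+1 ^ 4], and [q]
    stays free to be optimised. *)
Lemma crossing_inequality E q : embedded setT E ->
  (#|E| * q.+1 ^ 2 <= 3 * #|T| * q.+1 ^ 3 + #|crossings E|)%N.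
Proof.
move=> emb; have [ends_ vtx] := emb.
have one (g : {ffun T -> 'I_q.+1}) : (#|[set e in E | ends e \subset sample g]| <= 3 * #|sample g| +
    #|[set z in crossings E | ends z.1 :|: ends z.2 \subset sample g]|)%N.
  set Eg := [set e in E | _].
  have embg : embedded (sample g) Eg.
    split=> [e|e p]; rewrite [e \in Eg]inE => /andP[eE eg].
      by have [_ _ e12] := ends_ e eE; split=> //; apply: (subsetP eg); rewrite !inE eqxx ?orbT.
    by move=> _; apply: vtx.
  apply: leq_trans (card_edges_crossings embg) _; rewrite leq_add2l.
  apply/subset_leq_card/subsetP => z; rewrite !inE subUset.
  by case/and4P => /andP[-> ->] /andP[-> ->] -> ->.
have S2 : forall e, e \in E -> #|ends e| = 2.
  by move=> e /ends_[_ _]; apply: card_ends.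
pose a := (\sum_(g : {ffun T -> 'I_q.+1}) #|[set e in E | ends e \subset sample g]|)%N.
pose b := (\sum_(g : {ffun T -> 'I_q.+1}) #|sample g|)%N.
pose c := (\sum_(g : {ffun T -> 'I_q.+1})
  #|[set z in crossings E | ends z.1 :|: ends z.2 \subset sample g]|)%N.
have Sa : (a * _ = _)%N := sum_card_sampled q S2.
have Sb : (b * _ = _)%N := sum_card_sample T q.
have Sc : (c * _ = _)%N := sum_card_sampled q (fun z zX => card_crossing_ends emb zX).
have le : (a <= 3 * b + c)%N.
  by rewrite /b big_distrr -big_split; apply: leq_sum => g _; apply: one.
move: a b c le Sa Sb Sc.
have : (0 < q.+1 ^ #|T|)%N by rewrite expn_gt0.
move: #|T| #|E| #|crossings E| (q.+1 ^ #|T|)%N => t e x N N0 a b c le Sa Sb Sc.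
rewrite -(leq_pmul2r N0).
have : (a * q.+1 ^ 4 <= (3 * b + c) * q.+1 ^ 4)%N by rewrite leq_mul2r le orbT.
move: q.+1 Sa Sb Sc => r Sa Sb Sc.
rewrite mulnDl Sc mulnDl.
have -> : (a * r ^ 4 = e * r ^ 2 * N)%N by rewrite -mulnA (mulnC (r ^ 2)%N) mulnA -Sa -mulnA -expnD.
have -> : (3 * b * r ^ 4 = 3 * t * r ^ 3 * N)%N.
  rewrite (expnS r 3); move: (r ^ 3)%N => u.
  by rewrite (_ : 3 * b * (r * u) = 3 * (b * r) * u)%N; [rewrite Sb|]; lia.
by [].
Qed.

(** * Rich lines *)

Definition trace e : {set T} := [set r | height e (px r) == py r].

Lemma height_trace e f x : px f.1 < px f.2 ->
  f.1 \in trace e -> f.2 \in trace e -> height f x = height e x.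
Proof.
move=> f12; rewrite !inE => /eqP f1 /eqP f2.
have sl : slope f = slope e.
  have d0 : px f.2 - px f.1 != 0 by rewrite subr_eq0 gt_eqF.
  apply: (mulIf d0); rewrite {1}/slope divfK // -f1 -f2 (heightE e _ (px f.1)).
  by rewrite addrC addKr.
by rewrite (heightE f x (px f.1)) (heightE e x (px f.1)) height_left f1 sl.
Qed.

Lemma trace_eq e f : px f.1 < px f.2 ->
  f.1 \in trace e -> f.2 \in trace e -> trace f = trace e.
Proof.
by move=> f12 f1 f2; apply/setP => r; rewrite !inE (height_trace _ f12 f1 f2).
Qed.

Lemma mem_trace1 e : e.1 \in trace e.
Proof. by rewrite inE height_left. Qed.

Lemma mem_trace2 e : px e.1 < px e.2 -> e.2 \in trace e.
Proof. by move=> e12; rewrite inE height_right. Qed.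

Lemma trace_inj e p r : p \in trace e -> r \in trace e -> px p = px r -> p = r.
Proof.
rewrite !inE => /eqP hp /eqP hr pr; apply: pos_inj => //.
by rewrite -hp -hr pr.
Qed.

(* Only the non-vertical lines, given by their traces on the point set. *)
Definition rich_lines i : {set {set T}} := [set A : {set T} | (i <= #|A|)%N &&
  [exists e : T * T, (px e.1 < px e.2) && (A == trace e)]].

(* The segments between consecutive points of the lines in [rich_lines i]. *)
Definition rich_graph i : {set T * T} := [set e |
  [&& px e.1 < px e.2, (i <= #|trace e|)%N &
    [forall r, over e (px r) ==> (height e (px r) != py r)]]].

Lemma rich_graph_embedded i : embedded setT (rich_graph i).
Proof.
split=> [e | e p]; rewrite inE => /and3P[e12 _ /forallP h] //.
by move=> _; apply/implyP.
Qed.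

Lemma rich_graph_trace i e : e \in rich_graph i -> trace e \in rich_lines i.
Proof.
rewrite !inE => /and3P[e12 -> _] /=; apply/existsP; exists e; by rewrite e12 eqxx.
Qed.

(** Each point of the line except the rightmost, [z], is the left end of the segment to its
    successor [s]. *)
Lemma card_line_edges i A : A \in rich_lines i ->
  (i.-1 <= #|[set e in rich_graph i | trace e == A]|)%N.
Proof.
rewrite inE => /andP[iA /existsP[e0 /andP[e012 /eqP Ae]]].
have A1 : e0.1 \in A by rewrite Ae mem_trace1.
case: (arg_maxP px A1) => z; rewrite -/(z \in A) => zA zmax.
apply: leq_trans (leq_imset_card fst _).
apply: (@leq_trans #|A :\ z|).
  by rewrite (cardsD1 z A) zA in iA; rewrite -subn1 leq_subLR.
apply/subset_leq_card/subsetP => a; rewrite !inE => /andP[az aA].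
have ltaz : px a < px z.
  rewrite lt_neqAle [_ <= _]zmax // andbT; apply: contra az => /eqP h.
  by apply/eqP; apply: (@trace_inj e0); rewrite -?Ae.
pose P r := (r \in A) && (px a < px r).
have Pz : P z by rewrite /P zA.
case: (arg_minP px Pz) => s /andP[sA ltas] smin.
have tA : trace (a, s) = A by rewrite Ae; apply: trace_eq; rewrite -?Ae.
apply/imsetP; exists (a, s) => //; rewrite !inE tA eqxx ltas iA /= andbT.
apply/forallP => r; apply/implyP => /andP[/= ar rs]; apply/negP => h.
have : P r by rewrite /P ar andbT -tA inE.
by move/smin; rewrite leNgt rs.
Qed.

Lemma card_rich_graph i : (#|rich_lines i| * i.-1 <= #|rich_graph i|)%N.
Proof.
rewrite -[X in (_ <= X)%N]sum1_card.
rewrite (partition_big trace (mem (rich_lines i))); last exact: rich_graph_trace.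
rewrite -sum_nat_const; apply: leq_sum => A Ai.
apply: leq_trans (card_line_edges Ai) _.
by rewrite -sum1_card; under eq_bigl => e do rewrite inE.
Qed.

(** A crossing is determined by its ordered pair of lines: these meet at a single abscissa, and each
    line has only one edge over it. *)
Lemma card_rich_crossings i : (#|crossings (rich_graph i)| <= #|rich_lines i| ^ 2)%N.
Proof.
pose tr (z : (T * T) * (T * T)) := (trace z.1, trace z.2).
have emb := rich_graph_embedded i.
rewrite -mulnn -cardsX -(card_in_imset (f := tr)); last first.
  move=> [e f] [e' f'] /crossingsP[eE fE nef cr].
  case/crossingsP=> eE' fE' _ [x' [oe' of' ef']] [te tf].
  have sl := cross_slope emb eE fE nef cr; have [x [oe of_ ef]] := cr.
  have same a b : a \in rich_graph i -> b \in rich_graph i ->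
      trace a = trace b -> forall y, height a y = height b y.
    move=> aE bE tab y; have [_ _ a12] := emb.1 a aE.
    by apply: height_trace; rewrite -?tab ?mem_trace1 ?mem_trace2.
  have xx : x = x'.
    move: ef'; rewrite -(same _ _ eE eE' te) -(same _ _ fE fE' tf).
    rewrite (heightE e x' x) (heightE f x' x) ef => /addrI h.
    have : (slope e - slope f) * (x' - x) = 0 by rewrite mulrBl h subrr.
    by move/eqP; rewrite mulf_eq0 !subr_eq0 (negPf sl) => /eqP.
  (* Two distinct edges of one line over the same abscissa would cross with equal slopes. *)
  have uniq_over a b : a \in rich_graph i -> b \in rich_graph i ->
      trace a = trace b -> over a x -> over b x -> a = b.
    move=> aE bE tab oa ob; apply/eqP; apply/negPn/negP => nab.
    have hab := same _ _ aE bE tab.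
    have /eqP[] : slope a != slope b by apply: (cross_slope emb) => //; exists x.
    by have := hab 1; rewrite (heightE a 1 0) (heightE b 1 0) hab subr0 !mulr1 => /addrI.
  by congr pair; apply: uniq_over => //; rewrite xx.
apply/subset_leq_card/subsetP => _ /imsetP[[e f] + ->].
by case/crossingsP=> eE fE _ _; rewrite in_setX !(rich_graph_trace (i := i)).
Qed.

Lemma rich_lines_inequality i q :
  (#|rich_lines i| * i.-1 * q.+1 ^ 2 <=
     3 * #|T| * q.+1 ^ 3 + #|rich_lines i| ^ 2)%N.
Proof.
apply: leq_trans (leq_trans (crossing_inequality q (rich_graph_embedded i)) _).
  by rewrite leq_mul2r card_rich_graph orbT.
by rewrite leq_add2l card_rich_crossings.
Qed.

(** * Szemeredi-Trotter with vertical lines included *)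

Definition vertical_lines : {set {set T}} := preim_partition px [set: T].

Definition plane_lines : {set {set T}} := rich_lines 0 :|: vertical_lines.

(** Vertical lines are disjoint, so this is a direct count. *)
Lemma card_rich_vertical i :
  (#|[set A in vertical_lines | i <= #|A|]| * i <= #|T|)%N.
Proof.
rewrite -cardsT (card_partition (preim_partitionP px [set: T])) -sum_nat_const.
rewrite [X in (_ <= X)%N](bigID (fun A : {set T} => i <= #|A|)%N) /=.
apply: leq_trans (leq_addr _ _); rewrite (eq_bigl _ _ (fun A => in_set _ A)).
by apply: leq_sum => A /andP[].
Qed.

Lemma card_rich_plane_lines i :
  (#|[set A in plane_lines | i <= #|A|]| <=
    #|rich_lines i| + #|[set A in vertical_lines | i <= #|A|]|)%N.
Proof.
apply: leq_trans (leq_card_setU _ _); apply/subset_leq_card/subsetP => A.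
by rewrite !inE /= andb_orl => /orP[/andP[-> ->] | ->]; rewrite ?orbT.
Qed.

(** The vertical lines account for the thirteenth [D], as their number times [i] is at most [#|T|]
    and [i ^ 2 <= D * #|T|]. *)
Lemma szemeredi_trotter D i : (0 < i)%N -> (i ^ 2 <= D * #|T|)%N ->
  (#|[set A in plane_lines | i <= #|A|]| * i ^ 3 <= (2304 + 13 * D) * #|T| ^ 2)%N.
Proof.
move=> i0 iD; apply: leq_trans (leq_mul (card_rich_plane_lines i) (leqnn _)) _.
have cv := card_rich_vertical i.
rewrite mulnDl; apply: (@leq_trans ((2304 + 12 * D) * #|T| ^ 2 + D * #|T| ^ 2)); last first.
  by rewrite -mulnDl leq_mul2r; apply/orP; right; lia.
apply: leq_add; last first.
  rewrite (expnS i 2) mulnA; apply: leq_trans (leq_mul cv iD) _.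
  by rewrite mulnCA mulnn.
have [i2|] := ltnP 1 i.
  by apply: szemeredi_trotter_arith => // q; apply: rich_lines_inequality.
(* For [i = 1] the edge count [i.-1] is void; instead the non-vertical lines are counted by the
   pairs of points spanning them. *)
move=> i1; have -> : i = 1 by apply/eqP; rewrite eqn_leq i1.
rewrite exp1n muln1; apply: (@leq_trans (#|T| ^ 2)); last by rewrite leq_pmull.
rewrite -mulnn -card_prod -cardsT; apply: leq_trans (leq_imset_card trace _).
apply/subset_leq_card/subsetP => A; rewrite inE => /andP[_ /existsP[e /andP[_ /eqP ->]]].
by apply: imset_f; rewrite inE.
Qed.

(** * Collinear subsets *)

Definition plane_line a b c : {set T} := [set r | a * px r + b * py r == c].

Lemma plane_lines_equation A : A \in plane_lines ->
  exists a b c, (a, b) != (0, 0) /\ A = plane_line a b c.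
Proof.
case/setUP => [|/imsetP[p _ ->]].
  rewrite inE => /andP[_ /existsP[e /andP[_ /eqP ->]]].
  exists (- slope e), 1, (py e.1 - slope e * px e.1); split.
    by rewrite xpair_eqE oner_eq0 andbF.
  apply/setP => r; rewrite !inE /height -subr_eq0 -[RHS]subr_eq0 -[RHS]oppr_eq0.
  by congr (_ == _); ring.
exists 1, 0, (px p); split; first by rewrite xpair_eqE oner_eq0.
by apply/setP => r; rewrite !inE mul1r mul0r addr0 eq_sym.
Qed.

(** This makes the finite family [plane_lines] sufficient for arbitrary equations. When [b] is
    nonzero, [py] is a function of [px] on the line, so two distinct points have distinct abscissae
    and span it. *)
Lemma subset_plane_line a b c (B : {set T}) : (a, b) != (0, 0) ->
  (1 < #|B|)%N -> B \subset plane_line a b c ->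
  exists2 A, A \in plane_lines & B \subset A.
Proof.
move=> ab0 /card_gt1P[p [p' [pB p'B pp']]] /subsetP Bl.
have line r : r \in B -> a * px r + b * py r = c by move/Bl; rewrite inE => /eqP.
have [b0|b0] := eqVneq b 0.
  have a0 : a != 0 by move: ab0; rewrite xpair_eqE b0 eqxx andbT.
  exists [set r in setT | px p == px r]; first by apply/setUP; right; apply: imset_f.
  apply/subsetP => r rB; rewrite !inE /=; apply/eqP/(mulfI a0).
  by move: (line r rB) (line p pB); rewrite b0 !mul0r !addr0 => -> ->.
have pyE r : r \in B -> py r = (c - a * px r) / b.
  by move/line => <-; rewrite addrC addKr mulrC mulKf.
have [e [e1 e2 e12]] : exists e : T * T, [/\ e.1 \in B, e.2 \in B & px e.1 < px e.2].
  have [lt|lt|eq] := ltgtP (px p) (px p').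
  - by exists (p, p').
  - by exists (p', p).
  by case/eqP: pp'; apply: pos_inj => //; rewrite !pyE // eq.
exists (trace e).
  by rewrite !inE /=; apply/orP; left; apply/existsP; exists e; rewrite e12 eqxx.
apply/subsetP => r rB; rewrite inE /height /slope !pyE //; apply/eqP.
by field; rewrite b0 subr_eq0 gt_eqF.
Qed.

Definition collinear_sets m : {set {set T}} :=
  [set B : {set T} | (#|B| == m) && [exists A in plane_lines, B \subset A]].

Lemma card_collinear_sets m :
  (#|collinear_sets m| <= \sum_(A in plane_lines) #|A| ^ m)%N.
Proof.
apply: (@leq_trans (\sum_(A in plane_lines) \sum_(B : {set T} | (#|B| == m) && (B \subset A)) 1)).
  rewrite (exchange_big_dep (fun B : {set T} => #|B| == m)) /=; last first.
    by move=> A B _ /andP[].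
  rewrite -sum1_card big_mkcond [X in (_ <= X)%N]big_mkcond; apply: leq_sum => B _.
  rewrite inE; case: (#|B| == m) => //=; case: existsP => // -[A /andP[Al BA]].
  by rewrite (bigD1 A) ?Al ?BA //= leq_addr.
apply: leq_sum => A _; apply: leq_trans (leq_bin_exp _ _); rewrite -cards_draws -sum1_card.
by rewrite (eq_bigl _ _ (fun B => in_set _ B)); under eq_bigl => B do rewrite andbC.
Qed.

(* By Szemeredi-Trotter there are at most [M * #|T|] collinear [k.+1]-subsets. *)
Lemma large_subset_few_collinear D l k q (M := (k.+1 * (2304 + 13 * D) * #|T| * l ^ (k - 2))%N) :
  (3 <= k)%N -> (l ^ 2 <= D * #|T|)%N ->
  (forall a b c : R, (a, b) != (0, 0) -> (#|plane_line a b c| <= l)%N) ->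
  (2 * M <= q.+1 ^ k)%N ->
  exists Q : {set T}, (#|T| <= 2 * q.+1 * #|Q|)%N /\
    forall a b c : R, (a, b) != (0, 0) -> (#|Q :&: plane_line a b c| <= k)%N.
Proof.
move=> k3 lD Tl Mq; have k0 : (0 < k)%N by apply: leq_trans k3.
have Al A : A \in plane_lines -> (#|A| <= l)%N.
  by case/plane_lines_equation=> a [b [c [ab ->]]]; apply: Tl.
have few : (#|collinear_sets k.+1| <= M * #|T|)%N.
  apply: leq_trans (card_collinear_sets _) _.
  apply: leq_trans (sum_card_exp (M := (2304 + 13 * D) * #|T| ^ 2) k3 Al _) _.
    move=> i /andP[i0 il]; apply: szemeredi_trotter => //.
    by apply: leq_trans lD; rewrite leq_exp2r.
  by rewrite /M -mulnn; move: (l ^ _)%N => u; lia.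
have [] := @large_independent_set T q (collinear_sets k.+1) k.
- by move=> B; rewrite inE => /andP[/eqP].
- apply: leq_trans (leq_mul (leqnn 2) few) _.
  by rewrite mulnA mulnC leq_mul2l Mq orbT.
(* A line with more than [k] points of [Q] would contain a collinear [k.+1]-subset of [Q], contrary
   to independence. *)
move=> Q [TQ indep]; exists Q; split=> // a b c ab; rewrite leqNgt; apply/negP => big.
have : (0 < #|[set B : {set T} | B \subset Q :&: plane_line a b c & #|B| == k.+1]|)%N.
  by rewrite cards_draws bin_gt0.
case/card_gt0P => B; rewrite inE subsetI => /andP[/andP[BQ Bl] /eqP Bk].
have [|A Apl BA] := subset_plane_line ab _ Bl; first by rewrite Bk ltnS.
have /indep : B \in collinear_sets k.+1.
  by rewrite inE Bk eqxx; apply/existsP; exists A; rewrite Apl.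
by rewrite BQ.
Qed.
End PlaneGraph.

(** * Transfer to finite sets of real points, and choice of constants *)

Lemma fset_point_inj (R : realType) (P : {fset R * R}) (p q : P) :
  (val p).1 = (val q).1 -> (val p).2 = (val q).2 -> p = q.
Proof.
move=> h1 h2; apply: val_inj.
by rewrite [LHS]surjective_pairing h1 h2 -surjective_pairing.
Qed.

Lemma card_on_line (R : realType) (P : {fset R * R}) (X : {set P}) (a b c : R) :
  #|` [fset p in [fset val x | x in X] | on_line a b c p]%fset| =
  #|X :&: plane_line (fun x : P => (val x).1) (fun x : P => (val x).2) a b c|.
Proof.
set Y := X :&: _.
have -> : [fset p in [fset val x | x in X] | on_line a b c p]%fset =
    [fset val x | x in Y]%fset.
  apply/fsetP => p; rewrite !inE /=; apply/andP/imfsetP => /=.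
    move=> [/imfsetP[x /= xX ->] xl]; exists x => //.
    by rewrite !inE xX.
  move=> [x]; rewrite !inE => /andP[xX xl] ->; split=> //.
  by apply/imfsetP; exists x.
rewrite card_imfset /=; last exact: val_inj.
by rewrite cardE.
Qed.

Lemma f_lower_bound (R : realType) (n l k D q : nat) : (3 <= k)%N -> (k < l)%N ->
  (l ^ 2 <= D * n)%N ->
  (2 * (k.+1 * (2304 + 13 * D) * n * l ^ (k - 2)) <= q.+1 ^ k)%N ->
  (n <= 2 * q.+1 * f R n l k)%N.
Proof.
move=> k3 kl lD qk.
(* [guaranteed] asks for an exact size, so the least admissible [m] is fixed before the point set is
   given, and the large subset is later trimmed to [m] points. *)
have ex : exists m, (n <= 2 * q.+1 * m)%N by exists n; rewrite leq_pmull.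
case: (ex_minnP ex) => m mq mmin.
apply: leq_trans mq _; rewrite leq_mul2l; apply/orP; right.
apply: f_max => [|P Pn Pl]; first exact: leq_trans (ltnW k3) (ltnW kl).
pose px (x : P) := (val x).1; pose py (x : P) := (val x).2.
have Tn : #|{: P}| = n by rewrite -cardfE.
have inj (x y : P) : px x = px y -> py x = py y -> x = y := @fset_point_inj _ P x y.
have lines (a b c : R) : (a, b) != (0, 0) -> (#|plane_line px py a b c| <= l)%N.
  move=> /(Pl a b c); rewrite -{1}(setTI (plane_line px py a b c)) -card_on_line.
  congr (_ <= _)%N; congr #|` _|; apply/fsetP => p; rewrite !inE; congr (_ && _).
  apply/idP/imfsetP => [pP|[x _ ->]]; last exact: valP.
  by exists [` pP]%fset; rewrite ?inE.
have [||Q [nQ Qk]] := large_subset_few_collinear (D := D) inj k3 _ lines (q := q).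
- by rewrite Tn.
- by rewrite Tn.
rewrite Tn in nQ.
have : (0 < #|[set A : {set P} | A \subset Q & #|A| == m]|)%N.
  by rewrite cards_draws bin_gt0 mmin.
case/card_gt0P => A; rewrite inE => /andP[AQ /eqP Am].
exists [fset val x | x in A]%fset; split.
- by apply/fsubsetP => _ /imfsetP[x _ ->]; apply: valP.
- by rewrite card_imfset /=; [rewrite -Am cardE | exact: val_inj].
move=> a b c ab; rewrite card_on_line.
by apply: leq_trans (Qk a b c ab); rewrite subset_leq_card // setSI.
Qed.

Theorem theorem7 (R : realType) (k : nat) (hk : (3 <= k)%N) :
  forall C : R, 0 < C ->
  exists c : R, 0 < c /\
    forall n l : nat, (1 <= n)%N -> (k < l)%N ->
      l%:R <= C * Num.sqrt (n%:R : R) ->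
      c * ((n%:R `^ ((k%:R - 1) / k%:R)) / (l%:R `^ ((k%:R - 2) / k%:R)))
        <= (f R n l k)%:R.
Proof.
move=> C C0; pose D := Num.bound (C ^+ 2).
have CD : C ^+ 2 <= D%:R by rewrite ltW // archi_boundP // sqr_ge0.
pose K := (2 * (k.+1 * (2304 + 13 * D)))%N.
have k0 : (0 : R) < k%:R by rewrite ltr0n (leq_trans _ hk).
have Kn : (0 < K)%N by rewrite /K !muln_gt0 addn_gt0.
have K0 : (0 : R) < K%:R by rewrite ltr0n.
(* The root of [K] comes from the sampling rate; the 4 is the 2 of the alteration step times a 2 for
   rounding [Y] up to [q.+1]. *)
exists (4 * K%:R `^ (k%:R^-1))^-1; split; first by rewrite invr_gt0 mulr_gt0 // powR_gt0.
move=> n l n1 kl lC.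
have n0 : (0 : R) < n%:R by rewrite ltr0n.
have l0 : (0 : R) < l%:R by rewrite ltr0n (leq_trans _ kl).
have lD : (l ^ 2 <= D * n)%N.
  rewrite -(ler_nat R) natrX natrM.
  have := lerXn2r 2 (ltW l0 : l%:R \in Num.nneg) _ lC.
  rewrite exprMn sqr_sqrtr ?(ltW n0) // => /(_ _)/le_trans; apply.
    by rewrite nnegrE mulr_ge0 ?sqrtr_ge0 ?(ltW C0).
  by rewrite ler_pM2r.
pose M := (K * n * l ^ (k - 2))%N.
have M1 : (1 <= M)%N.
  by rewrite muln_gt0 muln_gt0 Kn n1 expn_gt0 (leq_trans _ kl).
pose Y : R := M%:R `^ k%:R^-1.
have Y1 : 1 <= Y.
  have <- : (1 : R) `^ k%:R^-1 = 1 by rewrite powR1.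
  by rewrite ge0_ler_powR ?nnegrE ?invr_ge0 ?ler1n ?ler0n // ltW.
have YM : Y ^+ k = M%:R.
  rewrite -powR_mulrn ?powR_ge0 // -powRrM mulVf ?powRr1 ?ler0n // gt_eqF //.
have Yprod : Y = K%:R `^ k%:R^-1 * n%:R `^ k%:R^-1 * l%:R `^ ((k%:R - 2) / k%:R).
  rewrite /Y /M !natrM natrX !powRM ?mulr_ge0 ?exprn_ge0 ?ler0n //.
  congr (_ * _); rewrite -powR_mulrn ?ler0n // -powRrM natrB //.
  by apply: leq_trans hk.
(* [Y] is the ideal inverse sampling rate. Rounding gives [Y < q.+1], so [M <= q.+1 ^ k], and
   [q.+1 <= 2 * Y] because [1 <= Y]. *)
pose q := Num.truncn Y.
have /andP[qY Yq] := truncn_itv (le_trans ler01 Y1); rewrite -/q in qY Yq.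
have nf : (n <= 2 * q.+1 * f R n l k)%N.
  apply: (@f_lower_bound _ _ _ _ D) => //.
  rewrite (_ : 2 * _ = M)%N; last by rewrite /M /K !mulnA.
  by rewrite -(ler_nat R) natrX -YM lerXn2r ?nnegrE ?ler0n ?(le_trans ler01 Y1) // ltW.
have nY : n%:R <= 4 * Y * (f R n l k)%:R.
  move: nf; rewrite -(ler_nat R) !natrM -natr1 => /le_trans; apply.
  by apply: ler_wpM2r; rewrite ?ler0n //; lra.
have npow : n%:R `^ ((k%:R - 1) / k%:R) = n%:R / n%:R `^ k%:R^-1 :> R.
  rewrite mulrBl divff ?gt_eqF // mul1r powRB ?(gt_eqF n0) ?implybT //.
  by rewrite powRr1 ?ler0n.
have Kp : 0 < K%:R `^ k%:R^-1 :> R by rewrite powR_gt0.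
have np : 0 < n%:R `^ k%:R^-1 :> R by rewrite powR_gt0.
have lp : 0 < l%:R `^ ((k%:R - 2) / k%:R) :> R by rewrite powR_gt0.
(* With [Y] expanded by [Yprod], the claimed bound is exactly [n / (4 * Y)]. *)
rewrite npow; apply: (@le_trans _ _ (n%:R / (4 * Y))); last first.
  have Y4 : 0 < 4 * Y by rewrite mulr_gt0 // (lt_le_trans ltr01 Y1).
  by rewrite ler_pdivrMr // mulrC.
rewrite Yprod le_eqVlt; apply/orP; left; apply/eqP; field.
by rewrite !gt_eqF.
Qed.
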